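(* Let $G$ be a finite simple undirected graph on $n$ vertices with at least one edge, let $A$ be its adjacency matrix, and let $\chi$ be the chromatic number of $G$. Let $S^+$ be the sum of the squares of the positive eigenvalues of $A$ and $S^-$ the sum of the squares of the negative eigenvalues of $A$ (eigenvalues counted with multiplicity). Then $$\chi\;\ge\;\frac{S^+}{S^-}.$$
   Context: The adjacency matrix of a graph on vertex set $\{1,\ldots,n\}$ is the $n\times n$ matrix $A=(a_{k\ell})$ with $a_{k\ell}=1$ if $(k,\ell)$ is an edge and $a_{k\ell}=0$ otherwise. The chromatic number $\chi$ is the least $c$ for which there is a map $\Phi:\{1,\ldots,n\}\to\{1,\ldots,c\}$ with $\Phi(k)\ne\Phi(\ell)$ whenever $a_{k\ell}=1$. *)

(* Defs.v *)
From mathcomp Require Import all_boot all_order all_algebra.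
Set Implicit Arguments.
Unset Strict Implicit.
Unset Printing Implicit Defensive.
Import Order.TTheory GRing.Theory Num.Theory.
Local Open Scope ring_scope.

Record sgraph (n : nat) := SGraph {
  edge : rel 'I_n;
  edge_sym : symmetric edge;
  edge_irr : irreflexive edge }.

Definition colorable (n : nat) (G : sgraph n) (c : nat) : bool :=
  [exists f : {ffun 'I_n -> 'I_c},
    [forall k, [forall l, edge G k l ==> (f k != f l)]]].

Lemma ex_colorable (n : nat) (G : sgraph n) : exists c, colorable G c.
Proof.
exists n; apply/existsP; exists [ffun k => k].
apply/forallP => k; apply/forallP => l; apply/implyP; rewrite !ffunE.
by apply: contraTneq => ->; rewrite edge_irr.
Qed.

Definition chromatic_number (n : nat) (G : sgraph n) : nat :=
  ex_minn (ex_colorable G).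

Definition adjmx (R : pzSemiRingType) (n : nat) (G : sgraph n) : 'M[R]_n :=
  \matrix_(k, l) (edge G k l)%:R.

(* Roots of the characteristic polynomial, repeated according to their
   multiplicity; the order of the sequence is unspecified. *)
Definition eigenvalues (C : closedFieldType) (n : nat) (A : 'M[C]_n) : seq C :=
  sval (closed_field_poly_normal (char_poly A)).

(* On a numClosedFieldType the order is partial: 0 < x and x < 0 each entail
   that x is real. No eigenvalue of a real symmetric matrix is lost, since all
   of them are real. *)
Definition sum_sq_pos_eigenvalues (C : numClosedFieldType) (n : nat)
    (A : 'M[C]_n) : C :=
  \sum_(x <- eigenvalues A | 0 < x) x ^+ 2.

Definition sum_sq_neg_eigenvalues (C : numClosedFieldType) (n : nat)
    (A : 'M[C]_n) : C :=
  \sum_(x <- eigenvalues A | x < 0) x ^+ 2.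

(* Main.v *)
Require Import Defs.
From mathcomp Require Import all_boot all_order all_algebra ring.
Set Implicit Arguments.
Unset Strict Implicit.
Unset Printing Implicit Defensive.
Import Order.TTheory GRing.Theory Num.Theory.
Local Open Scope ring_scope.

(** Write the adjacency matrix as A = B - N, where B and N are the positive and
    negative parts of A given by the spectral theorem.  Both are positive
    semidefinite, and their squared Frobenius norms are S^+ and S^-.

    A proper colouring with c colours cuts the matrices into c * c blocks, and A
    vanishes on the diagonal blocks, so B and N have the same diagonal blocks.
    A positive semidefinite matrix carries at least a fraction 1/c of its squared
    Frobenius norm on its c diagonal blocks ([frobenius_gram_le_blocks]).  Hence
    S^+ is at most c times the squared norm of the diagonal blocks of B.  These
    are the diagonal blocks of N, whose squared norm is at most S^-.  Taking c to
    be the chromatic number and dividing by S^- gives the theorem.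

    The estimate for a positive semidefinite B is the Cauchy-Schwarz inequality:
    if B = X^* X and the columns of X are sorted by colour into X_1, ..., X_c,
    then X X^* is the sum of the c matrices X_i X_i^*.  Passing from X^* X to
    X X^* does not change the Frobenius norm, for X_i as well as for X, and
    X_i^* X_i is the i-th diagonal block of B. *)

Local Open Scope sesquilinear_scope.

Definition frobenius_sq (C : numClosedFieldType) (m n : nat) (A : 'M[C]_(m, n)) : C :=
  \sum_i \sum_j `|A i j| ^+ 2.

Lemma frobenius_sqE (C : numClosedFieldType) (m n : nat) (A : 'M[C]_(m, n)) :
  frobenius_sq A = \tr (A *m A^t*).
Proof.
apply: eq_bigr => i _; rewrite mxE; apply: eq_bigr => j _.
by rewrite !mxE normCK.
Qed.

Lemma trmxC_mul (C : numClosedFieldType) (m n p : nat)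
    (A : 'M[C]_(m, n)) (B : 'M[C]_(n, p)) : (A *m B)^t* = B^t* *m A^t*.
Proof. by rewrite trmx_mul map_mxM. Qed.

Lemma frobenius_sq_gram (C : numClosedFieldType) (m n : nat) (X : 'M[C]_(m, n)) :
  frobenius_sq (X^t* *m X) = frobenius_sq (X *m X^t*).
Proof.
by rewrite !frobenius_sqE !trmxC_mul !trmxCK -mulmxA mxtrace_mulC !mulmxA.
Qed.

(** Expanding the sum of `|z i - z j|^2 over all pairs (i, j) gives twice the
    difference of the two sides. *)
Lemma normC_sum_sq_le (C : numClosedFieldType) (c : nat) (z : 'I_c -> C) :
  `|\sum_i z i| ^+ 2 <= c%:R * \sum_i `|z i| ^+ 2.
Proof.
have: 0 <= \sum_i \sum_j `|z i - z j| ^+ 2.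
  by apply: sumr_ge0 => i _; apply: sumr_ge0 => j _; rewrite exprn_ge0.
have ->: \sum_i \sum_j `|z i - z j| ^+ 2 =
    (c%:R * (\sum_i `|z i| ^+ 2) - `|\sum_i z i| ^+ 2) *+ 2.
  have sq_sum: `|\sum_i z i| ^+ 2 = \sum_i \sum_j z i * (z j)^*.
    rewrite normCK rmorph_sum mulr_suml.
    by apply: eq_bigr => i _; rewrite mulr_sumr.
  have sq_sumC: `|\sum_i z i| ^+ 2 = \sum_i \sum_j z j * (z i)^*.
    by rewrite sq_sum exchange_big.
  have const_l: c%:R * (\sum_i `|z i| ^+ 2) = \sum_(i < c) \sum_j `|z j| ^+ 2.
    by rewrite sumr_const card_ord mulr_natl.
  have const_r: c%:R * (\sum_i `|z i| ^+ 2) = \sum_i \sum_(j < c) `|z i| ^+ 2.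
    by rewrite exchange_big -const_l.
  rewrite mulr2n {1}const_l const_r {1}sq_sum sq_sumC.
  rewrite -!sumrB -big_split; apply: eq_bigr => i _ /=.
  rewrite -!sumrB -big_split; apply: eq_bigr => j _ /=.
  by rewrite !normCK rmorphB /=; ring.
by rewrite pmulrn_lge0 // subr_ge0.
Qed.

(** The c masked copies of X, one for each colour class of columns, have Gram
    matrices X_i X_i^* adding up to X X^*, so that [normC_sum_sq_le] applies in
    each entry. *)
Lemma frobenius_gram_le_blocks (C : numClosedFieldType) (m n c : nat)
    (X : 'M[C]_(m, n)) (f : 'I_n -> 'I_c) :
  frobenius_sq (X^t* *m X) <=
    c%:R * \sum_k \sum_(l | f k == f l) `|(X^t* *m X) k l| ^+ 2.
Proof.
pose Xc i : 'M[C]_(m, n) := \matrix_(a, k) (X a k *+ (f k == i)).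
have sum_gram: X *m X^t* = \sum_i Xc i *m (Xc i)^t*.
  apply/matrixP => a b; rewrite summxE !mxE.
  under [RHS]eq_bigr do rewrite mxE.
  rewrite exchange_big; apply: eq_bigr => k _ /=.
  rewrite (bigD1 (f k)) //= big1 => [|i ne_i]; first by rewrite !mxE eqxx addr0.
  by rewrite !mxE eq_sym (negPf ne_i) mul0r.
have gram_mask i k l :
    ((Xc i)^t* *m Xc i) k l = (X^t* *m X) k l *+ ((f k == i) && (f l == i)).
  rewrite !mxE; case: (boolP (_ && _)) => [/andP[ki li] | nkl].
    by apply: eq_bigr => a _; rewrite !mxE ki li.
  rewrite mulr0n big1 // => a _; rewrite !mxE.
  by move: nkl; rewrite negb_and => /orP[] /negPf->; rewrite ?rmorph0 ?mul0r ?mulr0.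
have -> : \sum_k \sum_(l | f k == f l) `|(X^t* *m X) k l| ^+ 2 =
    \sum_i frobenius_sq (Xc i *m (Xc i)^t*).
  under [RHS]eq_bigr do rewrite -frobenius_sq_gram.
  rewrite /frobenius_sq [RHS]exchange_big; apply: eq_bigr => k _ /=.
  rewrite [RHS]exchange_big big_mkcond; apply: eq_bigr => l _ /=.
  rewrite (bigD1 (f k)) //= big1 => [|i ne_i].
    by rewrite gram_mask eqxx eq_sym addr0; case: eqP; rewrite // normr0 expr0n.
  by rewrite gram_mask eq_sym (negPf ne_i) normr0 expr0n.
rewrite frobenius_sq_gram sum_gram /frobenius_sq [X in _ * X]exchange_big mulr_sumr.
apply: ler_sum => a _ /=; rewrite [X in _ * X]exchange_big mulr_sumr.
apply: ler_sum => b _ /=.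
by rewrite summxE normC_sum_sq_le.
Qed.

Lemma frobenius_sq_unitary_diag (C : numClosedFieldType) (n : nat)
    (U : 'M[C]_n) (d : 'rV[C]_n) : U \is unitarymx ->
  frobenius_sq (U^t* *m diag_mx d *m U) = \sum_i `|d 0 i| ^+ 2.
Proof.
move=> U_unitary; rewrite frobenius_sqE !trmxC_mul trmxCK !mulmxA mxtrace_mulC.
rewrite !mulmxA (unitarymxP U_unitary) mul1mx -!mulmxA.
rewrite [U *m _]mulmxA (unitarymxP U_unitary) mul1mx.
rewrite tr_diag_mx map_diag_mx mulmx_diag mxtrace_diag.
by apply: eq_bigr => i _; rewrite !mxE normCK.
Qed.

Lemma diag_congr_gram (C : numClosedFieldType) (n : nat)
    (U : 'M[C]_n) (d : 'rV[C]_n) : (forall i, 0 <= d 0 i) ->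
  exists X : 'M[C]_n, U^t* *m diag_mx d *m U = X^t* *m X.
Proof.
move=> d_ge0; exists (diag_mx (\row_i sqrtC (d 0 i)) *m U).
rewrite trmxC_mul tr_diag_mx map_diag_mx !mulmxA -[_ *m diag_mx _ *m diag_mx _]mulmxA.
rewrite mulmx_diag; congr (_ *m diag_mx _ *m _); apply/rowP => i; rewrite !mxE.
by rewrite /= geC0_conj ?sqrtC_ge0 // -expr2 sqrtCK.
Qed.

Lemma char_poly_conj (F : fieldType) (n : nat) (P A : 'M[F]_n) :
  P \in unitmx -> char_poly (invmx P *m A *m P) = char_poly A.
Proof.
move=> P_unit; rewrite /char_poly.
have PVP : map_mx polyC (invmx P) *m map_mx polyC P = 1%:M.
  by rewrite -map_mxM mulVmx // map_mx1.
have -> : char_poly_mx (invmx P *m A *m P) =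
    map_mx polyC (invmx P) *m char_poly_mx A *m map_mx polyC P.
  rewrite /char_poly_mx mulmxBr mulmxBl !map_mxM; congr (_ - _).
  by rewrite scalar_mxC -mulmxA PVP mulmx1.
by rewrite !det_mulmx mulrC mulrA [X in X * _]mulrC -det_mulmx PVP det1 mul1r.
Qed.

(** Both sequences list the roots of the characteristic polynomial with
    multiplicity, so they agree up to order. *)
Lemma perm_eigenvalues_spectral_diag (C : numClosedFieldType) (n : nat)
    (A : 'M[C]_n) : A \is normalmx ->
  perm_eq (eigenvalues A) [seq spectral_diag A 0 i | i <- enum 'I_n].
Proof.
move=> /orthomx_spectralP A_diag; apply: prod_XsubC_eq.
rewrite /eigenvalues; case: closed_field_poly_normal => r /= A_split.
rewrite (monicP (char_poly_monic A)) scale1r in A_split; rewrite -A_split.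
rewrite A_diag char_poly_conj ?spectral_unit // char_poly_trig ?diag_mx_is_trig //.
rewrite big_map big_enum; apply: eq_bigr => i _ /=.
by rewrite -A_diag mxE eqxx mulr1n.
Qed.

(** Chain the two estimates through the diagonal blocks: they hold at least 1/c
    of the squared norm of the positive part, agree with the diagonal blocks of
    the negative part because A is zero there, and so hold at most the squared
    norm of the negative part. *)
Lemma sum_sq_eigenvalues_le_of_zero_blocks (C : numClosedFieldType) (n c : nat)
    (A : 'M[C]_n) (f : 'I_n -> 'I_c) : A \is hermsymmx ->
    (forall k l, f k = f l -> A k l = 0) ->
  sum_sq_pos_eigenvalues A <= c%:R * sum_sq_neg_eigenvalues A.
Proof.
move=> A_herm A_blocks; have A_normal := hermitian_normalmx A_herm.
pose U := spectralmx A; pose d := spectral_diag A.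
have U_unitary : U \is unitarymx := spectral_unitarymx A.
have d_real i : d 0 i \is Num.real.
  exact: (mxOverP (hermitian_spectral_diag_real A_herm)).
pose dp : 'rV[C]_n := \row_i (if 0 < d 0 i then d 0 i else 0).
pose dm : 'rV[C]_n := \row_i (if d 0 i < 0 then - d 0 i else 0).
have dE : d = dp - dm.
  apply/rowP => i; rewrite !mxE.
  by case: (real_ltgt0P (d_real i)) => [||->]; rewrite ?subr0 ?opprK ?add0r.
have dp_ge0 i : 0 <= dp 0 i by rewrite mxE; case: ifP => // /ltW.
have dm_ge0 i : 0 <= dm 0 i by rewrite mxE; case: ifP => // /ltW; rewrite oppr_ge0.
pose B := U^t* *m diag_mx dp *m U; pose N := U^t* *m diag_mx dm *m U.
have A_split : A = B - N.
  rewrite -mulmxBl -mulmxBr -raddfB -dE -(invmx_unitary U_unitary).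
  exact: orthomx_spectralP.
have [X BX] := diag_congr_gram U dp_ge0.
have -> : sum_sq_pos_eigenvalues A = frobenius_sq B.
  rewrite frobenius_sq_unitary_diag // /sum_sq_pos_eigenvalues.
  rewrite (perm_big _ (perm_eigenvalues_spectral_diag A_normal)) big_map big_enum_cond.
  rewrite big_mkcond; apply: eq_bigr => i _; rewrite ger0_norm // mxE -/d /=.
  by case: ifP; rewrite // expr0n.
have -> : sum_sq_neg_eigenvalues A = frobenius_sq N.
  rewrite frobenius_sq_unitary_diag // /sum_sq_neg_eigenvalues.
  rewrite (perm_big _ (perm_eigenvalues_spectral_diag A_normal)) big_map big_enum_cond.
  rewrite big_mkcond; apply: eq_bigr => i _; rewrite ger0_norm // mxE -/d /=.
  by case: ifP; rewrite ?sqrrN // expr0n.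
have BN_blocks k l : f k = f l -> B k l = N k l.
  by move=> fkl; apply/eqP; rewrite -subr_eq0 -(A_blocks k l fkl) A_split !mxE.
rewrite {1}/B BX (le_trans (frobenius_gram_le_blocks X f)) // -BX -/B.
rewrite ler_wpM2l ?ler0n // ler_sum // => k _; rewrite big_mkcond ler_sum // => l _.
by case: eqP => [/BN_blocks-> // | _]; rewrite exprn_ge0.
Qed.

Lemma adjmx_hermsym (C : numClosedFieldType) (n : nat) (G : sgraph n) :
  adjmx C G \is hermsymmx.
Proof.
apply/is_hermitianmxP; rewrite expr0 scale1r.
by apply/matrixP => k l; rewrite !mxE edge_sym /= conjC_nat.
Qed.

Theorem theorem1p3 (C : numClosedFieldType) (n : nat) (G : sgraph n)
    (has_edge : exists k l : 'I_n, edge G k l) :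
  (chromatic_number G)%:R >=
    sum_sq_pos_eigenvalues (adjmx C G) / sum_sq_neg_eigenvalues (adjmx C G).
Proof.
have /existsP[f f_proper] : colorable G (chromatic_number G).
  by rewrite /chromatic_number; case: ex_minnP.
have := @sum_sq_eigenvalues_le_of_zero_blocks C n _ _ f (adjmx_hermsym C G).
have blocks0 k l : f k = f l -> adjmx C G k l = 0.
  move=> fkl; rewrite mxE; move/forallP/(_ k)/forallP/(_ l): f_proper.
  by rewrite fkl eqxx implybF => /negPf->.
move=> /(_ blocks0); set Sneg := sum_sq_neg_eigenvalues _ => S_le.
have: 0 <= Sneg.
  by apply: sumr_ge0 => x /ltW x_le0; rewrite -sqrrN exprn_ge0 ?oppr_ge0.
(* In case S^- = 0 the quotient is 0 by the convention on inverses. *)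
rewrite le_eqVlt => /orP[/eqP <- | Sneg_gt0]; first by rewrite invr0 mulr0 ler0n.
by rewrite ler_pdivrMr.
Qed.
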